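(* Let $k$ be an algebraically closed field of characteristic zero and let $q\in k$ with $q^i\neq 1$ for every nonzero integer $i$. Let $f\in k(t,x)$ be such that, over the algebraic closure $\overline{k(t)}$ of $k(t)$, $f=\sum_{i=1}^m \frac{\alpha_i}{x-\beta_i}$ with $\alpha_i,\beta_i\in\overline{k(t)}$, all $\alpha_i\neq 0$, and the $\beta_i$ pairwise distinct. Then there exist a nonzero operator $L\in k(t)\langle Q_t\rangle$ and $g\in k(t,x)$ with $L(f)=D_x(g)$ if and only if all the $\beta_i$ lie in $k$.
   Context: $D_x=\partial/\partial x$ on $k(t,x)$; $Q_t$ is the $q$-shift automorphism $Q_t(h(t,x))=h(qt,x)$ of $k(t,x)$. $k(t)\langle Q_t\rangle$ is the ring of operators $\sum_{\ell=0}^{\rho}e_\ell Q_t^\ell$ with $e_\ell\in k(t)$, acting on $k(t,x)$. *)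

(* Defs.v *)
From HB Require Import structures.
From mathcomp Require Import all_boot all_order all_algebra.
From mathcomp Require Import ring.

Set Implicit Arguments.
Unset Strict Implicit.
Unset Printing Implicit Defensive.

Import GRing.Theory.
Local Open Scope ring_scope.
Local Open Scope quotient_scope.

Notation "x %:F" := (@FracField.tofrac _ x) : ring_scope.

(* F(x) *)
Notation ratfrac F := {fraction {poly F}}.

(* k(t,x), presented as k(t)(x) *)
Notation ratfrac2 k := (ratfrac (ratfrac k)).

(* [fracmap phi] and [fracderiv] act on the numerator and denominator of a
   chosen representative; [fracmapE] and [fracderivE] below show that any other
   representative gives the same value. *)
Definition fracmap (R S : idomainType) (phi : R -> S) (u : {fraction R}) :
    {fraction S} :=
  (phi \n_(repr u))%:F / (phi \d_(repr u))%:F.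

Definition fracderiv (F : fieldType) (u : ratfrac F) : ratfrac F :=
  let n := \n_(repr u) in let d := \d_(repr u) in
  (n^`() * d - n * d^`())%:F / (d ^+ 2)%:F.

Lemma frac_numden (R : idomainType) (u : {fraction R}) :
  u = (\n_(repr u))%:F / (\d_(repr u))%:F.
Proof.
set r := repr u; have d0 : \d_r != 0 := denom_ratioP r.
rewrite -[u]reprK -/r -[X in \pi X]Ratio_numden; unlock FracField.tofrac.
transitivity (\pi_({fraction R}) (FracField.mulf (Ratio \n_r 1)
                (FracField.invf (Ratio \d_r 1)))).
  by rewrite /FracField.mulf /FracField.invf !numden_Ratio ?oner_neq0 //
    mulr1 mul1r.
by rewrite FracField.pi_mul FracField.pi_inv.
Qed.

Lemma frac_reprE (R : idomainType) (a b : R) (u : {fraction R}) : b != 0 ->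
  u = a%:F / b%:F -> a * \d_(repr u) = \n_(repr u) * b.
Proof.
move=> b0 E; apply/eqP; rewrite -tofrac_eq !tofracM.
by rewrite -eqr_div ?tofrac_eq0 ?denom_ratioP // -E -frac_numden.
Qed.

Lemma fracmapE (R S : idomainType) (phi : {rmorphism R -> S}) (a b : R) :
  injective phi -> b != 0 ->
  fracmap phi (a%:F / b%:F) = (phi a)%:F / (phi b)%:F.
Proof.
move=> inj_phi b0; rewrite /fracmap; set u : {fraction R} := a%:F / b%:F.
have /(congr1 phi) E := frac_reprE b0 (erefl u); rewrite !rmorphM in E.
have phi0 x : x != 0 -> (phi x)%:F != 0 :> {fraction S}.
  by rewrite tofrac_eq0 -(inj_eq inj_phi) rmorph0.
apply/eqP; rewrite eqr_div ?phi0 ?denom_ratioP // -!tofracM tofrac_eq.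
by rewrite E.
Qed.

Lemma fracderivE (F : fieldType) (a b : {poly F}) : b != 0 ->
  fracderiv (a%:F / b%:F) = (a^`() * b - a * b^`())%:F / (b ^+ 2)%:F.
Proof.
move=> b0; rewrite /fracderiv; set u : ratfrac F := a%:F / b%:F.
have E := frac_reprE b0 (erefl u).
have E' := congr1 (@deriv F) E; rewrite !derivM in E'.
apply/eqP; rewrite eqr_div ?tofrac_eq0 ?expf_neq0 ?denom_ratioP //.
rewrite -!tofracM tofrac_eq -subr_eq0; apply/eqP.
move: E E'; set n := \n_(repr u); set d := \d_(repr u).
move: (a^`()) (b^`()) (n^`()) (d^`()) => a' b' n' d' E E'.
transitivity ((n' * b + n * b' - (a' * d + a * d')) * (b * d)
  + (a * d - n * b) * (b * d' + b' * d)); first by ring.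
by rewrite E E' !subrr !mul0r addr0.
Qed.

Section ShiftOperators.
Variables (k : fieldType) (q : k).

(* h(t) |-> h(qt) *)
Definition qshift1 : ratfrac k -> ratfrac k :=
  fracmap (fun p : {poly k} => p \Po (q *: 'X)).

(* Q_t : h(t,x) |-> h(qt,x) *)
Definition qshift : ratfrac2 k -> ratfrac2 k := fracmap (map_poly qshift1).

(* The action of L = \sum_l e_l Q_t^l.  An element of k(t)<Q_t> is given by its
   coefficient sequence, stored as a polynomial in Q_t; only the additive
   structure of {poly _} is meaningful here, since in k(t)<Q_t> the
   coefficients do not commute with Q_t. *)
Definition qop_apply (L : {poly ratfrac k}) (h : ratfrac2 k) : ratfrac2 k :=
  \sum_(l < size L) (L`_l)%:P%:F * iter l qshift h.

End ShiftOperators.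

(* An algebraic closure of k(t): an algebraically closed field K, with an
   embedding k(t) -> K over which every element of K is algebraic. *)
Definition is_algebraic_closure (F : fieldType) (K : closedFieldType)
    (iota : {rmorphism F -> K}) : Prop :=
  forall z : K, algebraicOver iota z.

(* Main.v *)
(* Write f = n / d in lowest terms over k(t).

   If all beta_i are constants, d is fixed by Q_t, so the Q_t^l f share the
   denominator d and their numerators have bounded degree; a linear dependence
   among them gives L with L(f) = 0.

   Conversely d is separable, since its roots are the distinct beta_i.  If some
   beta_i is not in k, its minimal polynomial p over k(t) has a coefficient
   outside k, and as no element of k(t) outside k is fixed by a power of Q_t,
   the Q_t^l p are pairwise distinct.  Only finitely many of them divide d;
   let p' be the last one.  With rho the order of L, the factor
   P = Q_t^rho p' occurs in the denominator of e_rho Q_t^rho f, once, and in no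
   other term of L(f), whereas a derivative never has a simple pole at P. *)
Require Import Defs.
From HB Require Import structures.
From mathcomp Require Import all_boot all_order all_algebra all_field.
From mathcomp Require Import ring.
From Stdlib Require Import Classical.

Set Implicit Arguments.
Unset Strict Implicit.
Unset Printing Implicit Defensive.

Import GRing.Theory.
Local Open Scope ring_scope.

(** * Fractions and the morphisms induced on them *)

Lemma frac_ex (R : idomainType) (u : {fraction R}) :
  exists a b : R, b != 0 /\ u = a%:F / b%:F.
Proof.
by exists \n_(repr u), \d_(repr u); rewrite denom_ratioP -frac_numden.
Qed.

Lemma frac_coprime (F : fieldType) (u : ratfrac F) :
  exists n d : {poly F}, [/\ d != 0, coprimep n d & u = n%:F / d%:F].
Proof.
have [n [d [d0 ->]]] := frac_ex u.
have g0 : gcdp n d != 0 by rewrite gcdp_eq0 negb_and d0 orbT.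
have En : n %/ gcdp n d * gcdp n d = n by rewrite divpK ?dvdp_gcdl.
have Ed : d %/ gcdp n d * gcdp n d = d by rewrite divpK ?dvdp_gcdr.
exists (n %/ gcdp n d), (d %/ gcdp n d); split.
- by apply: contraNneq d0 => E; rewrite -Ed E mul0r.
- by rewrite coprimep_div_gcd // d0 orbT.
move: (gcdp n d) En Ed g0 => g En Ed g0.
rewrite -[in LHS]En -[in LHS]Ed !tofracM -mulf_div divff ?mulr1 //.
by rewrite tofrac_eq0.
Qed.

Section FracMorphism.
Variables (R S : idomainType) (phi : {rmorphism R -> S}).
Hypothesis inj_phi : injective phi.

Lemma fracmap_tofrac a : fracmap phi a%:F = (phi a)%:F.
Proof.
by rewrite -[a%:F]divr1 -tofrac1 fracmapE ?oner_neq0 // rmorph1 tofrac1 divr1.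
Qed.

(** Injectivity keeps denominators nonzero, so additivity and multiplicativity reduce to those of
    [phi]. Bundling the map as a morphism makes the lemmas on [map_poly] applicable to it. *)
Lemma fracmap_rmorphism :
  exists psi : {rmorphism {fraction R} -> {fraction S}}, psi =1 fracmap phi.
Proof.
have phi0 b : b != 0 -> phi b != 0 by rewrite -(inj_eq inj_phi) rmorph0.
have zm : zmod_morphism (fracmap phi).
  move=> u v; have [a [b [b0 ->]]] := frac_ex u.
  have [c [d [d0 ->]]] := frac_ex v.
  rewrite -mulNr addf_div ?tofrac_eq0 // mulNr -!tofracM -tofracB.
  rewrite !fracmapE ?mulf_neq0 // rmorphB !rmorphM /=.
  by rewrite -[- (_ / _)]mulNr addf_div ?tofrac_eq0 ?phi0 // mulNr -!tofracM
    -tofracB.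
have mm : monoid_morphism (fracmap phi).
  split=> [|u v]; first by rewrite -tofrac1 fracmap_tofrac rmorph1.
  have [a [b [b0 ->]]] := frac_ex u.
  have [c [d [d0 ->]]] := frac_ex v.
  by rewrite mulf_div -!tofracM !fracmapE ?mulf_neq0 // !rmorphM /= mulf_div.
pose za := GRing.isZmodMorphism.Build _ _ _ zm.
pose ma := GRing.isMonoidMorphism.Build _ _ _ mm.
pose psi : {rmorphism {fraction R} -> {fraction S}} :=
  HB.pack (fracmap phi) za ma.
by exists psi.
Qed.

End FracMorphism.

(** * The scaling t -> rt on k(t) and its fixed elements *)

Section Scaling.
Variable k : fieldType.
Implicit Types (r s : k) (u : ratfrac k).

Lemma size_scaleX r : r != 0 -> size (r *: 'X : {poly k}) = 2.
Proof. by move=> r0; rewrite size_scale // size_polyX. Qed.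

Lemma comp_scaleX_inj r : r != 0 ->
  injective (comp_poly (r *: 'X) : {poly k} -> {poly k}).
Proof.
move=> r0 a b /eqP; rewrite -subr_eq0 -rmorphB /=.
rewrite comp_poly2_eq0 ?size_scaleX //.
by rewrite subr_eq0 => /eqP.
Qed.

Lemma qshift1E r (a b : {poly k}) : r != 0 -> b != 0 ->
  qshift1 r (a%:F / b%:F) = (a \Po (r *: 'X))%:F / (b \Po (r *: 'X))%:F.
Proof.
by move=> r0 b0; apply: fracmapE => //; apply: comp_scaleX_inj.
Qed.

Lemma qshift1_rmorphism r : r != 0 ->
  exists psi : {rmorphism ratfrac k -> ratfrac k}, psi =1 qshift1 r.
Proof. by move=> r0; apply: fracmap_rmorphism; apply: comp_scaleX_inj. Qed.

Lemma qshift1_const r (c : k) : r != 0 -> qshift1 r c%:P%:F = c%:P%:F.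
Proof.
move=> r0; rewrite [LHS](fracmap_tofrac (phi := comp_poly (r *: 'X))) /=.
  by rewrite comp_polyC.
exact: comp_scaleX_inj.
Qed.

Lemma qshift1M r s u : r != 0 -> s != 0 ->
  qshift1 r (qshift1 s u) = qshift1 (r * s) u.
Proof.
move=> r0 s0; have [a [b [b0 ->]]] := frac_ex u.
have bs0 : b \Po (s *: 'X) != 0 by rewrite comp_poly2_eq0 ?size_scaleX.
rewrite [qshift1 s _]qshift1E // !qshift1E ?mulf_neq0 // -!comp_polyA.
by rewrite !comp_polyZ comp_polyX scalerA [s * r]mulrC.
Qed.

Lemma qshift1_1 u : qshift1 1 u = u.
Proof.
have [a [b [b0 ->]]] := frac_ex u.
by rewrite qshift1E ?oner_neq0 // scale1r !comp_polyXr.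
Qed.

(** The equation says that a/b is fixed by t -> rt. Scaling multiplies the leading coefficient of
    [a] by r^(deg a), so comparing both sides gives r^(deg a) = r^(deg b), and [r] is not a root of
    unity. *)
Lemma size_comp_scale_eq r (a b : {poly k}) :
  r != 0 -> (forall i, (0 < i)%N -> r ^+ i != 1) -> a != 0 -> b != 0 ->
  (a \Po (r *: 'X)) * b = a * (b \Po (r *: 'X)) -> size a = size b.
Proof.
move=> r0 hr a0 b0 /(congr1 lead_coef).
rewrite !lead_coefM !lead_coef_comp ?size_scaleX // lead_coefZ lead_coefX mulr1.
rewrite mulrAC -!mulrA => /(mulfI _) -/(_ _).
rewrite lead_coef_eq0 => /(_ a0) /(mulfI _) -/(_ _).
rewrite lead_coef_eq0 => /(_ b0) E.
have injr i j : (i < j)%N -> r ^+ i != r ^+ j.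
  move=> ij; rewrite -(subnKC (ltnW ij)) exprD -{1}[r ^+ i]mulr1.
  by rewrite (inj_eq (mulfI (expf_neq0 _ r0))) eq_sym hr ?subn_gt0.
rewrite -(prednK (_ : 0 < size a)%N) -1?(prednK (_ : 0 < size b)%N)
  ?size_poly_gt0 //.
by congr _.+1; case: (ltngtP (size a).-1 (size b).-1) => // /injr;
  rewrite E eqxx.
Qed.

(* Subtracting from u = a/b the ratio of the leading coefficients lowers the
   degree of the numerator, whereas a nonzero fixed fraction has numerator and
   denominator of the same degree. *)
Lemma qshift1_fixed r u :
  r != 0 -> (forall i, (0 < i)%N -> r ^+ i != 1) ->
  qshift1 r u = u -> exists c : k, u = c%:P%:F.
Proof.
move=> r0 hr fixu; have [a [b [b0 Eu]]] := frac_ex u.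
have cb0 : b \Po (r *: 'X) != 0 by rewrite comp_poly2_eq0 ?size_scaleX.
have [a0|a0] := eqVneq a 0; first by
  exists 0; rewrite Eu a0 polyC0 tofrac0 mul0r.
have E : (a \Po (r *: 'X)) * b = a * (b \Po (r *: 'X)).
  move: fixu; rewrite Eu qshift1E // => /eqP.
  by rewrite eqr_div ?tofrac_eq0 // -!tofracM tofrac_eq => /eqP.
have sab := size_comp_scale_eq r0 hr a0 b0 E.
pose c := lead_coef a / lead_coef b.
exists c; suff /eqP d0 : a - c *: b == 0.
  move/eqP: d0; rewrite subr_eq0 => /eqP Ea; rewrite Eu Ea -mul_polyC tofracM.
  by rewrite mulfK // tofrac_eq0.
apply/negPn/negP => d0.
have sd : size (a - c *: b) = size b.
  apply: size_comp_scale_eq r0 hr d0 b0 _.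
  by rewrite rmorphB /= comp_polyZ !mulrBl E -!scalerAl [b * _]mulrC.
have lb0 : lead_coef b != 0 by rewrite lead_coef_eq0.
move: d0; rewrite -lead_coef_eq0 lead_coefE sd coefB coefZ -{1}sab -!lead_coefE.
by rewrite /c divfK ?subrr ?eqxx.
Qed.

End Scaling.

Lemma fracderiv0 (F : fieldType) : fracderiv (0 : ratfrac F) = 0.
Proof.
rewrite -[0](mul0r (1%:F)^-1) -{1}tofrac0 fracderivE ?oner_neq0 //.
by rewrite deriv0 !mul0r subrr tofrac0 mul0r.
Qed.

(** * Irreducible factors of denominators and poles of derivatives *)

Section Poles.
Variable F : fieldType.
Implicit Types (p P A B : {poly F}) (u : ratfrac F).

Lemma coprimep_neq0r P B : (1 < size P)%N -> coprimep P B -> B != 0.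
Proof.
move=> sP; apply: contraTneq => ->.
by rewrite coprimep0 -size_poly_eq1 gtn_eqF.
Qed.

Lemma size_mul_gtl A P :
  A != 0 -> (1 < size P)%N -> (size A < size (A * P)%R)%N.
Proof.
move=> A0 sP; rewrite size_mul //; last by rewrite -size_poly_gt0 ltnW.
by rewrite -(subnK sP) addn2 !addnS /= ltnS leq_addr.
Qed.

Lemma irredp_pfactor P B : irreducible_poly P -> B != 0 ->
  exists e B1, coprimep P B1 /\ B = P ^+ e * B1.
Proof.
move=> irrP; have [sP _] := irrP.
have [n] := ubnP (size B); elim: n B => // n IH B ltB B0.
have [/dvdpP[C E]|nPB] := boolP (P %| B); last first.
  by exists 0, B; rewrite irreducible_poly_coprime // expr0 mul1r.
have C0 : C != 0 by apply: contraNneq B0 => C0; rewrite E C0 mul0r.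
have P0 := irredp_neq0 irrP.
have [|//|e [B1 [cB1 EC]]] := IH C.
  by rewrite -ltnS (leq_trans _ ltB) // ltnS E size_mul_gtl.
by exists e.+1, B1; rewrite E EC exprSr mulrAC.
Qed.

(** Supplies the minimal polynomial of [z] over [F], by descent: if [D] is reducible, [z] is a root
    of one of two proper factors. *)
Lemma irredp_factor_root (K : fieldType) (h : {rmorphism F -> K})
    (D : {poly F}) (z : K) :
  D != 0 -> root (map_poly h D) z ->
  exists p, [/\ irreducible_poly p, p \is monic, p %| D
              & root (map_poly h p) z].
Proof.
have [n] := ubnP (size D); elim: n D => // n IH D ltD D0 Dz.
have sD : (1 < size D)%N.
  rewrite -(size_map_poly h) (root_size_gt1 _ Dz) // map_poly_eq0 //.
have [irrD|] := classic (irreducible_poly D).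
  have l0 : (lead_coef D)^-1 != 0 by rewrite invr_eq0 lead_coef_eq0.
  exists ((lead_coef D)^-1 *: D); split.
  - split=> [|d sd]; first by rewrite size_scale.
    rewrite dvdpZr // => dD.
    by rewrite (eqp_trans (irrD.2 d sd dD)) // eqp_sym eqp_scale.
  - by rewrite monicE lead_coefZ mulVf // lead_coef_eq0.
  - by rewrite dvdpZl.
  by rewrite map_polyZ rootZ // fmorph_eq0.
move=> nirr; have {nirr} [d [sd dD ndD]] :
    exists d : {poly F}, [/\ size d != 1, d %| D & ~~ (d %= D)].
  apply: NNPP => no; apply: nirr; split=> // d sd dD; apply: NNPP => /negP nd.
  by apply: no; exists d.
have /dvdpP[c E] := dD.
have d0 : d != 0 by apply: contraNneq D0 => Z; rewrite E Z mulr0.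
have c0 : c != 0 by apply: contraNneq D0 => Z; rewrite E Z mul0r.
move: Dz; rewrite {1}E rmorphM rootM => /orP[] z0.
  have cD : c %| D by rewrite E dvdp_mulr.
  have [|//|//|p [? ? pc ?]] := IH c.
    rewrite -ltnS (leq_trans _ ltD) // ltnS E size_mul_gtl //.
    by rewrite ltn_neqAle eq_sym sd size_poly_gt0.
  by exists p; split=> //; apply: dvdp_trans cD.
have [|//|//|p [? ? pd ?]] := IH d.
  rewrite -ltnS (leq_trans _ ltD) // ltnS ltn_neqAle dvdp_leq // andbT.
  by rewrite dvdp_size_eqp.
by exists p; split=> //; apply: dvdp_trans dD.
Qed.

Lemma irredp_monic_ncoprime p p' :
  irreducible_poly p -> p \is monic -> irreducible_poly p' -> p' \is monic ->
  p != p' -> coprimep p p'.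
Proof.
move=> irrp mp irrp' mp'; rewrite irreducible_poly_coprime //.
apply: contra => d.
by rewrite -eqp_monic // irrp'.2 // gtn_eqF // irrp.1.
Qed.

(* Each divisor in the sequence splits off a factor of D. *)
Lemma dvdp_seq_bounded (s : nat -> {poly F}) (D : {poly F}) :
  (forall n, irreducible_poly (s n)) -> (forall n, s n \is monic) ->
  injective s -> D != 0 -> exists N, forall n, (N <= n)%N -> ~~ (s n %| D).
Proof.
move=> irr mon inj; have [m] := ubnP (size D).
elim: m D => // m IH D ltD D0.
have [[n0 /dvdpP[D' E]]|no] := classic (exists n, s n %| D); last first.
  by exists 0%N => n _; apply/negP => d; apply: no; exists n.
have D'0 : D' != 0 by apply: contraNneq D0 => Z; rewrite E Z mul0r.
have [|//|N hN] := IH D'.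
  by rewrite -ltnS (leq_trans _ ltD) // ltnS E size_mul_gtl // (irr n0).1.
(* Past [n0], injectivity makes [s n] differ from [s n0], hence coprime to it, so [s n] can divide
   [D] only by dividing [D']. *)
exists (maxn N n0.+1) => n; rewrite geq_max => /andP[Nn n0n].
rewrite E Gauss_dvdpl ?hN // irredp_monic_ncoprime //.
by rewrite (inj_eq inj) gtn_eqF.
Qed.

(** For irreducible [P] this is membership in the localization of F[x] at [P]. The fraction need not
    be reduced, so a sum is handled by multiplying denominators. *)
Definition regular_at P u := exists A B, coprimep P B /\ u = A%:F / B%:F.

Lemma regular_at_sum P (I : Type) (r : seq I) (S : pred I)
    (u : I -> ratfrac F) :
  (1 < size P)%N -> (forall i, S i -> regular_at P (u i)) ->
  regular_at P (\sum_(i <- r | S i) u i).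
Proof.
move=> sP reg; elim/big_rec: _ => [|i v Si [A [B [cB ->]]]].
  by exists 0, 1; rewrite coprimep1 tofrac0 mul0r.
have [C [D [cD ->]]] := reg i Si.
exists (C * B + A * D), (D * B); rewrite coprimepMr cD cB; split=> //.
by rewrite addf_div ?tofrac_eq0 ?(coprimep_neq0r sP) // tofracD !tofracM.
Qed.

Hypothesis char0 : [pchar F] =i pred0.

(* Let u = A/B in lowest terms, with P^e exactly dividing B.  If e > 0, then
   P^(e-1) exactly divides A' B - A B' and P^(2e) exactly divides B^2, so u'
   has a pole of order e + 1 at P; if e = 0, it has none. *)
Lemma fracderiv_no_simple_pole P W V u :
  irreducible_poly P -> coprimep P P^`() -> coprimep P W -> coprimep P V ->
  fracderiv u <> W%:F / (P * V)%:F.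
Proof.
move=> irrP sepP cW cV; have [A [B [B0 cAB ->]]] := frac_coprime u.
have P0 := irredp_neq0 irrP; have sP := irrP.1.
have V0 := coprimep_neq0r sP cV.
rewrite fracderivE // => /eqP.
rewrite eqr_div ?tofrac_eq0 ?expf_neq0 ?mulf_neq0 // -!tofracM tofrac_eq.
move/eqP.
have [[|e] [B1 [cB1 EB]]] := irredp_pfactor irrP B0.
  rewrite expr0 mul1r in EB; rewrite -EB in cB1.
  move=> /(congr1 (coprimep P)); rewrite !coprimepMr cW cB1 coprimepp.
  by rewrite gtn_eqF // andbF.
have cA : coprimep P A.
  rewrite coprimep_sym; apply: coprimep_dvdl cAB.
  by rewrite EB exprS -mulrA dvdp_mulr.
rewrite EB derivM deriv_exp /= -mulr_natl => E.
have {E} : (A^`() * P * B1 - A * (e.+1%:R * P^`() * B1 + P * B1^`())) * V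
    = P ^+ e * (P * (W * B1 ^+ 2)).
  apply: (mulfI (expf_neq0 e.+1 P0)); move: E; rewrite !exprS.
  set Pe := P ^+ e => E.
  transitivity ((A^`() * (P * Pe * B1) - A * (e.+1%:R * (P^`() * Pe) * B1
    + P * Pe * B1^`())) * (P * V)); first by ring.
  by rewrite E; ring.
move=> /(congr1 (coprimep P)); rewrite !coprimepMr coprimepp gtn_eqF //.
rewrite andbF cV andbT.
(* Modulo [P] only -(e+1) A P' B1 survives. It is coprime to [P], since e+1 is nonzero in
   characteristic zero and [P] is coprime to its derivative. *)
have -> : A^`() * P * B1 - A * (e.+1%:R * P^`() * B1 + P * B1^`())
   = (A^`() * B1 - A * B1^`()) * P + (- e.+1%:R) * (A * P^`() * B1) by ring.
rewrite coprimep_addl_mul -polyC_natr -polyCN mul_polyC coprimepZr.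
  by rewrite !coprimepMr cA sepP cB1.
by rewrite oppr_eq0 (pcharf0P F).1.
Qed.

End Poles.

(** * The shift acting on polynomials in x over k(t) *)

Section PolyShift.
Variable k : fieldType.
Implicit Types (r s : k) (p d : {poly ratfrac k}).

(** The scale [r] is left arbitrary so that each power of Q_t, and its inverse, is an instance. *)
Definition pshift r p : {poly ratfrac k} := map_poly (qshift1 r) p.

Lemma pshift_rmorphism r : r != 0 ->
  exists psi : {rmorphism ratfrac k -> ratfrac k}, pshift r =1 map_poly psi.
Proof.
move=> r0; have [psi E] := qshift1_rmorphism r0; exists psi => p.
by apply/eq_map_poly => u; rewrite E.
Qed.

Lemma coef_pshift r p i : r != 0 -> (pshift r p)`_i = qshift1 r p`_i.
Proof.
move=> r0; have [psi E] := qshift1_rmorphism r0.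
have -> : pshift r p = map_poly psi p by apply/eq_map_poly => u; rewrite E.
by rewrite coef_map /= E.
Qed.

Lemma pshiftM r s p : r != 0 -> s != 0 ->
  pshift r (pshift s p) = pshift (r * s) p.
Proof.
by move=> r0 s0; apply/polyP => i; rewrite !coef_pshift ?mulf_neq0 ?qshift1M.
Qed.

Lemma pshift1 p : pshift 1 p = p.
Proof. by apply/polyP => i; rewrite coef_pshift ?oner_neq0 ?qshift1_1. Qed.

Lemma pshiftK r p : r != 0 -> pshift r (pshift r^-1 p) = p.
Proof. by move=> r0; rewrite pshiftM ?invr_neq0 // divff // pshift1. Qed.

Lemma size_pshift r p : r != 0 -> size (pshift r p) = size p.
Proof. by case/pshift_rmorphism=> psi E; rewrite E size_map_poly. Qed.

Lemma pshift_eq0 r p : r != 0 -> (pshift r p == 0) = (p == 0).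
Proof. by move=> r0; rewrite -!size_poly_eq0 size_pshift. Qed.

Lemma pshift_inj r : r != 0 -> injective (pshift r).
Proof.
case/pshift_rmorphism=> psi E p d; rewrite !E.
exact/map_inj_poly/rmorph0/fmorph_inj.
Qed.

Lemma dvdp_pshift r d p : r != 0 -> (pshift r d %| pshift r p) = (d %| p).
Proof. by case/pshift_rmorphism=> psi E; rewrite !E dvdp_map. Qed.

Lemma coprimep_pshift r d p :
  r != 0 -> coprimep (pshift r d) (pshift r p) = coprimep d p.
Proof. by case/pshift_rmorphism=> psi E; rewrite !E coprimep_map. Qed.

Lemma separable_pshift r p :
  r != 0 -> separable_poly (pshift r p) = separable_poly p.
Proof. by case/pshift_rmorphism=> psi E; rewrite E separable_map. Qed.

Lemma monic_pshift r p : r != 0 -> (pshift r p \is monic) = (p \is monic).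
Proof. by case/pshift_rmorphism=> psi E; rewrite E map_monic. Qed.

Lemma irreducible_pshift r p :
  r != 0 -> irreducible_poly p -> irreducible_poly (pshift r p).
Proof.
move=> r0 [sp irrp]; split=> [|d]; first by rewrite size_pshift.
rewrite -(pshiftK d r0) size_pshift // dvdp_pshift // => sd dp.
by rewrite /eqp !dvdp_pshift // -/(eqp _ _); apply: irrp.
Qed.

Lemma pshift_fixed r p :
  r != 0 -> (forall i, (0 < i)%N -> r ^+ i != 1) -> pshift r p = p ->
  exists p0 : {poly k}, p = map_poly (fun c => c%:P%:F) p0.
Proof.
move=> r0 hr fixp.
have cst i : exists c : k, p`_i == c%:P%:F.
  have [|c ->] := qshift1_fixed (u := p`_i) r0 hr; last by exists c.
  by rewrite -coef_pshift ?fixp.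
exists (\poly_(i < size p) xchoose (cst i)); apply/polyP => i.
rewrite coef_map_id0 ?polyC0 ?tofrac0 // coef_poly.
case: ltnP => [_|si]; first exact/eqP/(xchooseP (cst i)).
by rewrite nth_default // polyC0 tofrac0.
Qed.

Lemma iter_qshift r l (n d : {poly ratfrac k}) : r != 0 -> d != 0 ->
  iter l (qshift r) (n%:F / d%:F) =
    (pshift (r ^+ l) n)%:F / (pshift (r ^+ l) d)%:F.
Proof.
move=> r0 d0; elim: l => [|l IH]; first by rewrite /= expr0 !pshift1.
have rl0 := expf_neq0 l r0.
rewrite iterS IH exprS -!pshiftM //.
have [psi E] := pshift_rmorphism r0; rewrite 2!E.
have qE u : qshift r u = fracmap (map_poly psi) u by rewrite /fracmap -!E.
rewrite qE fracmapE ?pshift_eq0 //.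
exact/map_inj_poly/rmorph0/fmorph_inj.
Qed.

End PolyShift.

(** * Existence and non-existence of telescopers *)

Section Telescopers.
Variables (k : fieldType) (q : k).
Hypotheses (q0 : q != 0) (hq : forall i, (0 < i)%N -> q ^+ i != 1).
Implicit Types (n d p : {poly ratfrac k}).

Let qn0 l : q ^+ l != 0. Proof. exact: expf_neq0. Qed.

(* A constant denominator is common to all Q_t^l f, whose numerators span a
   space of dimension at most [size n]. *)
Lemma const_denom_telescoper n d :
  d != 0 -> (forall l, pshift (q ^+ l) d = d) ->
  exists L, L != 0 /\ qop_apply q L (n%:F / d%:F) = 0.
Proof.
move=> d0 fixd; pose s := size n.
(* One row more than columns forces a nonzero vector in the left kernel; its entries become the
   coefficients of [L]. *)
pose M : 'M[ratfrac k]_(s.+1, s) := \matrix_(l, i) (pshift (q ^+ l) n)`_i.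
have /rowV0Pn[v vM v0] : kermx M != 0.
  rewrite kermx_eq0 -row_leq_rank -ltnNge ltnS rank_leq_col //.
move/sub_kermxP in vM.
exists (\poly_(l < s.+1) (v 0 (inord l))); split.
  apply: contraNneq v0 => L0; apply/eqP/rowP => l; rewrite mxE.
  move/polyP/(_ l): L0; rewrite coef0 coef_poly ltn_ord => <-.
  by congr (v _ _); apply/val_inj; rewrite /= inordK.
rewrite /qop_apply; set L := \poly_(l < _) _.
rewrite -(big_mkord predT
  (fun l => (L`_l)%:P%:F * iter l (qshift q) (n%:F / d%:F))).
under eq_bigr => l _ do rewrite iter_qshift // fixd mulrA -tofracM.
rewrite -mulr_suml -rmorph_sum /=.
suff -> : \sum_(0 <= l < size L) (L`_l)%:P * pshift (q ^+ l) n = 0.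
  by rewrite tofrac0 mul0r.
(* The last entries of [v] may vanish, making [size L] smaller than [s.+1]; zero terms pad the sum
   to the rows of [M]. *)
rewrite (big_nat_widen _ _ s.+1) ?size_poly //=.
have -> : \sum_(0 <= l < s.+1 | (l < size L)%N) (L`_l)%:P * pshift (q ^+ l) n
   = \sum_(0 <= l < s.+1) (L`_l)%:P * pshift (q ^+ l) n.
  rewrite [LHS]big_mkcond; apply: eq_bigr => l _; case: ltnP => // sl.
  by rewrite nth_default // polyC0 mul0r.
rewrite big_mkord; apply/polyP => i; rewrite coef0 coef_sum.
have [si|si] := ltnP i s; last first.
  rewrite big1 // => l _; rewrite coefCM [(pshift _ _)`_i]nth_default ?mulr0 //.
  by rewrite size_pshift.
move/rowP/(_ (Ordinal si)): vM; rewrite !mxE.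
apply: etrans; apply: eq_bigr => l _.
by rewrite coefCM coef_poly ltn_ord mxE inord_val.
Qed.

Lemma nonconst_pole_no_telescoper n d p L g :
  [pchar k] =i pred0 -> coprimep n d -> separable_poly d ->
  irreducible_poly p -> p \is monic -> p %| d ->
  (forall l, (0 < l)%N -> pshift (q ^+ l) p != p) ->
  L != 0 -> qop_apply q L (n%:F / d%:F) <> fracderiv g.
Proof.
move=> char0 cnd sepd irrp0 monp0 p0d nfix L0.
have d0 := separable_poly_neq0 sepd.
(* Cancelling the smaller shift reduces a coincidence of two shifts to [p] being fixed by a positive
   power. *)
have inj : injective (fun l => pshift (q ^+ l) p).
  suff lt i j : (i < j)%N -> pshift (q ^+ i) p <> pshift (q ^+ j) p.
    by move=> i j E; case: (ltngtP i j) => // /lt; rewrite E.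
  move=> ij; rewrite -(subnKC (ltnW ij)) exprD -pshiftM //.
  by move/(pshift_inj (qn0 i))/esym/eqP; apply/negP/nfix; rewrite subn_gt0.
have [N hN] := dvdp_seq_bounded (fun l => irreducible_pshift (qn0 l) irrp0)
  (fun l => etrans (monic_pshift p (qn0 l)) monp0) inj d0.
have ex : exists l, pshift (q ^+ l) p %| d by exists 0%N; rewrite expr0 pshift1.
have ub l : pshift (q ^+ l) p %| d -> (l <= N)%N.
  by move=> dl; rewrite leqNgt; apply: contraL dl => /ltnW/hN.
(* [a] is the last exponent whose shift of [p] divides [d]; by its maximality every further shift of
   [p'] is coprime to [d]. *)
have [a pad maxa] := ex_maxnP ex ub.
move: (irreducible_pshift (qn0 a) irrp0) pad; set p' := pshift _ p => irrp p'd.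
have cop l : (0 < l)%N -> coprimep (pshift (q ^+ l) p') d.
  move=> l0; rewrite irreducible_poly_coprime; last exact: irreducible_pshift.
  rewrite pshiftM // -exprD; apply/negP => /maxa.
  by rewrite -{2}[a]add0n leq_add2r leqNgt l0.
clearbody p'; pose rho := (size L).-1; pose P := pshift (q ^+ rho) p'.
have sL : size L = rho.+1 by rewrite prednK // size_poly_gt0.
have irrP : irreducible_poly P := irreducible_pshift (qn0 _) irrp.
have sP := irrP.1.
(* For l < rho, [P] is the l-th shift of a proper shift of [p'], which is coprime to [d]; applying
   Q_t^l makes [P] coprime to the denominator of the l-th term. *)
have regP : regular_at P (\sum_(l < rho)
    (L`_l)%:P%:F * iter l (qshift q) (n%:F / d%:F)).
  apply: regular_at_sum => // l _.
  exists ((L`_l)%:P * pshift (q ^+ l) n), (pshift (q ^+ l) d); split.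
    have [lrho Erho] := (ltn_ord l, subnKC (ltnW (ltn_ord l))).
    have -> : P = pshift (q ^+ l) (pshift (q ^+ (rho - l)) p').
      by rewrite pshiftM // -exprD Erho.
    by rewrite coprimep_pshift // cop // subn_gt0.
  by rewrite iter_qshift // tofracM mulrA.
(* Separability passes to the shifted [d], so [P] occurs in it exactly once and [D1] is coprime to
   [P]. *)
have /dvdpP[D1 ED] : P %| pshift (q ^+ rho) d by rewrite dvdp_pshift.
have : separable_poly (pshift (q ^+ rho) d) by rewrite separable_pshift.
rewrite ED separable_mul => /and3P[_ sepP cD1].
rewrite coprimep_sym in cD1.
have cN : coprimep P (pshift (q ^+ rho) n).
  by rewrite coprimep_pshift // coprimep_sym; apply: coprimep_dvdl cnd.
have [U [V [cV EUV]]] := regP.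
rewrite /qop_apply sL big_ord_recr /= EUV iter_qshift // ED => /esym.
have P0 := irredp_neq0 irrP; have V0 := coprimep_neq0r sP cV.
have D10 := coprimep_neq0r sP cD1.
rewrite mulrA -tofracM addf_div ?tofrac_eq0 ?mulf_neq0 // -!tofracM -tofracD.
rewrite [V * _]mulrC [D1 * P]mulrC -[P * D1 * V]mulrA.
apply: fracderiv_no_simple_pole => //.
- apply/(pcharf0P _).2 => i; rewrite -tofrac1 -polyC1 -!rmorphMn tofrac_eq0 /=.
  by rewrite polyC_eq0 (pcharf0P k).1.
- by move: sepP; rewrite unlock.
(* Modulo [P] the numerator is the leading coefficient of [L] times the shifted [n] times [V], all
   coprime to [P]. *)
- rewrite [P * D1]mulrC mulrA coprimep_addl_mul mul_polyC -scalerAl coprimepZr.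
    by rewrite coprimepMr cN.
  by rewrite -[rho]/(size L).-1 -lead_coefE lead_coef_eq0.
- by rewrite coprimepMr cD1.
Qed.

End Telescopers.

(** * Sums of simple fractions and roots of constant polynomials *)

Section SimpleFractions.
Variables (K : fieldType) (m : nat) (alpha beta : 'I_m -> K).

Definition residue_num : {poly K} :=
  \sum_i (alpha i)%:P * \prod_(j | j != i) ('X - (beta j)%:P).

Lemma sum_simple_frac :
  \sum_(i < m) (alpha i)%:P%:F / ('X - (beta i)%:P)%:F =
    residue_num%:F / (\prod_(i < m) ('X - (beta i)%:P))%:F.
Proof.
rewrite /residue_num rmorph_sum mulr_suml; apply: eq_bigr => i _.
set B := \prod_(j | _) _.
have -> : \prod_(j < m) ('X - (beta j)%:P) = ('X - (beta i)%:P) * B.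
  exact: bigD1.
have B0 : B%:F != 0 by rewrite tofrac_eq0 prodf_seq_neq0; apply/allP=> j _;
  rewrite polyXsubC_eq0 implybT.
by rewrite /= !tofracM -mulf_div divff // mulr1.
Qed.

(** At beta_i all summands but the i-th vanish, leaving alpha_i times the product of the differences
    beta_i - beta_j. *)
Lemma residue_num_neq0 i :
  alpha i != 0 -> injective beta -> residue_num.[beta i] != 0.
Proof.
move=> a0 inj; rewrite /residue_num horner_sum (bigD1 i) //= [X in _ + X]big1.
  rewrite addr0 hornerM hornerC mulf_neq0 // horner_prod prodf_seq_neq0.
  apply/allP => j _; apply/implyP => ji.
  by rewrite hornerXsubC subr_eq0 (inj_eq inj) eq_sym.
move=> j ji; rewrite hornerM (bigD1 i) 1?eq_sym //=.
by rewrite hornerM hornerXsubC subrr mul0r mulr0.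
Qed.

End SimpleFractions.

(** Since [k] is algebraically closed, [p] already splits over [k], and a larger field adds no
    roots. *)
Lemma constant_poly_root (k : closedFieldType) (K : fieldType)
    (h : {rmorphism k -> K}) (p : {poly k}) (z : K) :
  p != 0 -> root (map_poly h p) z -> exists c, z = h c.
Proof.
move=> p0; have [r ->] := closed_field_poly_normal p.
rewrite map_polyZ rootZ ?fmorph_eq0 ?lead_coef_eq0 // rmorph_prod /=.
under eq_bigr => c _ do rewrite map_polyXsubC.
rewrite -(big_map h predT (fun c => 'X - c%:P)) root_prod_XsubC.
by case/mapP=> c _ ->; exists c.
Qed.

(** * Telescopers and constancy of the poles *)

Theorem theorem4p7 (k : closedFieldType) (char0 : [pchar k] =i pred0)
    (q : k) (q_neq0 : q != 0) (hq : forall i : int, i != 0 -> q ^ i != 1)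
    (K : closedFieldType) (iota : {rmorphism ratfrac k -> K})
    (closK : is_algebraic_closure iota)
    (f : ratfrac2 k) (m : nat) (alpha beta : 'I_m -> K)
    (hf : fracmap (map_poly iota) f =
          \sum_(i < m) (alpha i)%:P%:F / ('X - (beta i)%:P)%:F)
    (alpha_neq0 : forall i, alpha i != 0)
    (beta_inj : injective beta) :
  (exists (L : {poly ratfrac k}) (g : ratfrac2 k),
      L != 0 /\ qop_apply q L f = fracderiv g)
  <->
  (forall i, exists c : k, beta i = iota (c%:P)%:F).
Proof.
have qn1 i : (0 < i)%N -> q ^+ i != 1.
  by move=> i0; apply: (hq i%:Z); rewrite -lt0n.
have [n [d [d0 cnd Ef]]] := frac_coprime f.
pose cst : {rmorphism k -> ratfrac k} := @FracField.tofrac {poly k} \o @polyC k.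
pose B := \prod_(i < m) ('X - (beta i)%:P).
have B0 : B != 0.
  by rewrite prodf_seq_neq0; apply/allP=> i _; rewrite polyXsubC_eq0 implybT.
have E : map_poly iota n * B = residue_num alpha beta * map_poly iota d.
  move: hf; rewrite sum_simple_frac Ef fracmapE //; last first.
    exact/map_inj_poly/rmorph0/fmorph_inj.
  move/eqP; rewrite eqr_div ?tofrac_eq0 ?map_poly_eq0 // -!tofracM tofrac_eq.
  by move/eqP.
split=> [[L [g [L0 Lg]]] i|hc].
- have Bi : root B (beta i).
    by rewrite /root horner_prod (bigD1 i) //= hornerXsubC subrr mul0r.
  (* At beta_i, [B] vanishes while [residue_num] does not, so [E] forces [d] to vanish. *)
  have di : root (map_poly iota d) (beta i).
    move/(congr1 (horner^~ (beta i)))/esym: E.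
    rewrite !hornerM (rootP Bi) mulr0.
    by move/eqP; rewrite mulf_eq0 (negPf (residue_num_neq0 _ _)).
  (* As [n] and [d] are coprime, [E] makes [d] a divisor of [B]; it then inherits separability from
     the distinctness of the beta_i. *)
  have dB : map_poly iota d %| B.
    have cdn : coprimep (map_poly iota d) (map_poly iota n).
      by rewrite coprimep_map coprimep_sym.
    by rewrite -(Gauss_dvdpr _ cdn) E dvdp_mull.
  have sepd : separable_poly d.
    have: separable_poly B.
      rewrite /B -(big_map beta predT (fun z => 'X - z%:P)).
      by rewrite separable_prod_XsubC map_inj_uniq // index_enum_uniq.
    move/dvdpP: dB => [C ->]; rewrite separable_mul => /and3P[_ + _].
    by rewrite separable_map.
  have [p [irrp monp pd pi]] := irredp_factor_root d0 di.
  (* If a positive power of Q_t fixes [p], its coefficients lie in [k], hence so does its root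
     beta_i; otherwise [L] cannot exist. *)
  have [[l [l0 fixp]]|nfix] :=
      classic (exists l, (0 < l)%N /\ pshift (q ^+ l) p = p).
    have [|j j0|p0 Ep] := pshift_fixed _ _ fixp.
    + exact: expf_neq0.
    + by rewrite -exprM qn1 // muln_gt0 l0.
    have hE : map_poly iota p = map_poly (iota \o cst) p0.
      by rewrite Ep -map_poly_comp.
    have p00 : p0 != 0.
      apply: contraTneq monp => p00.
      by rewrite Ep p00 map_poly0 monicE lead_coef0 eq_sym oner_eq0.
    by rewrite hE in pi; have [c ->] := constant_poly_root p00 pi; exists c.
  case: (nonconst_pole_no_telescoper q_neq0 (g := g) char0 cnd sepd irrp monp
    pd _ L0).
    by move=> l l0; apply/eqP => fixp; apply: nfix; exists l.
  by rewrite -Ef.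
have [c hc'] := fin_all_exists hc.
pose D := \prod_(i < m) ('X - (cst (c i))%:P).
have D0 : D != 0.
  by rewrite prodf_seq_neq0; apply/allP=> i _; rewrite polyXsubC_eq0 implybT.
have BD : map_poly iota D = B.
  by rewrite rmorph_prod; apply: eq_bigr => i _; rewrite /= map_polyXsubC hc'.
(* Over [K], [D] becomes [B] and [E] gives the divisibility, which descends to k(t). Thus [f] can be
   rewritten with the constant denominator [D]. *)
have /dvdpP[n' En'] : d %| n * D.
  by rewrite -(dvdp_map iota) rmorphM /= BD E dvdp_mull.
have -> : f = n'%:F / D%:F.
  by rewrite Ef; apply/eqP; rewrite eqr_div ?tofrac_eq0 // -!tofracM En'.
have [L [L0 LE]] : exists L, L != 0 /\ qop_apply q L (n'%:F / D%:F) = 0.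
  apply: const_denom_telescoper => // l.
  have ql0 := expf_neq0 l q_neq0.
  have [psi Epsi] := qshift1_rmorphism ql0.
  have -> : pshift (q ^+ l) D = map_poly psi D.
    by apply/eq_map_poly => u; rewrite Epsi.
  rewrite rmorph_prod; apply: eq_bigr => i _.
  by rewrite /= map_polyXsubC Epsi qshift1_const.
by exists L, 0; rewrite LE fracderiv0.
Qed.
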